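(* Let $\mathcal{ANK}\subset\mathcal{Z}\cong\mathbb{CP}^3$ be the set of maximal non-integrable structures on $SU(2)\times SU(2)$ (those $I\in\mathcal{Z}$ at which $I\mapsto\|N_I\|^2$ attains its maximum over $\mathcal{Z}$). Then $$\mathcal{ANK}=\bigcup_{(r,x,u)\in\mathbb{R}^3,\ r^2+x^2+u^2=1} C_{p_+p_-},$$ where, for each $(r,x,u)$ with $r^2+x^2+u^2=1$, the points $p_+,p_-\in\mathcal{Z}$ are those with fundamental 2-forms $$p_+=e^5\wedge e^6+r(e^1\wedge e^2+e^3\wedge e^4)+x(e^1\wedge e^3+e^4\wedge e^2)+u(e^1\wedge e^4+e^2\wedge e^3),$$ $$p_-=-e^5\wedge e^6-r(e^1\wedge e^2-e^3\wedge e^4)-x(e^1\wedge e^3-e^4\wedge e^2)+u(e^1\wedge e^4-e^2\wedge e^3),$$ and $C_{p_+p_-}$ is the equatorial circle of the edge joining $p_+$ and $p_-$.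
   Context: Lie algebra: $\mathfrak{g}=\mathfrak{su}(2)\times\mathfrak{su}(2)$ has basis $e_1,\dots,e_6$ with $[e_1,e_2]=e_3$, $[e_1,e_3]=-e_2$, $[e_2,e_3]=e_1$, $[e_4,e_5]=e_6$, $[e_4,e_6]=-e_5$, $[e_5,e_6]=e_4$ and $[e_i,e_j]=0$ for $i\in\{1,2,3\}$, $j\in\{4,5,6\}$; $e^1,\dots,e^6$ is the dual basis of $\mathfrak{g}^*$. The Killing-Cartan metric $B$ equals $2g$, where $g$ is the inner product making $e_1,\dots,e_6$ orthonormal; $B$ and $g$ have the same orthogonal endomorphisms, and fundamental forms are taken with respect to $g$. The space $\mathcal{Z}$: the set of linear $I:\mathfrak{g}\to\mathfrak{g}$ with $I^2=-1$, $g(IX,IY)=g(X,Y)$, inducing the orientation of $(e_1,\dots,e_6)$, i.e. $(X_1,IX_1,X_2,IX_2,X_3,IX_3)$ is positively oriented whenever it is a basis. These are the left-invariant orthogonal almost complex structures on $SU(2)\times SU(2)$ inducing this orientation. The fundamental form of $I$ is $\omega(X,Y)=g(IX,Y)$; it determines $I$, and points of $\mathcal{Z}$ are labelled by their fundamental forms. $I$ acts on $\mathfrak{g}^*$ by $(I\alpha)(X)=\alpha(IX)$. Nijenhuis tensor: $N_I(X,Y)=[IX,IY]-[X,Y]-I[X,IY]-I[IX,Y]$ for $X,Y\in\mathfrak{g}$; $\|N_I\|^2=\sum_{i,j,k=1}^6 (N_{ij}^k)^2$ where $N_I(e_i,e_j)=\sum_k N_{ij}^k e_k$. Identification $\mathcal{Z}\cong\mathbb{CP}^3$: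 let $V=\mathbb{C}^4$ with unitary basis $v^0,v^1,v^2,v^3$, and identify $\Lambda^2V$ with $\mathfrak{g}^*\otimes\mathbb{C}$ by $2v^0\wedge v^1=e^1+ie^2$, $2v^2\wedge v^3=e^1-ie^2$, $2v^0\wedge v^2=e^3+ie^4$, $2v^3\wedge v^1=e^3-ie^4$, $2v^0\wedge v^3=e^5+ie^6$, $2v^1\wedge v^2=e^5-ie^6$. The point $[w]\in P(V)=\mathbb{CP}^3$ corresponds to the unique $I\in\mathcal{Z}$ whose $i$-eigenspace $\{\alpha-iI\alpha\}$ in $\mathfrak{g}^*\otimes\mathbb{C}$ is $V_w=\{w\wedge v: v\in V\}$. Edges and equators: for distinct $z,u\in\mathbb{CP}^3$ the edge $E_{zu}$ is the projective line through $z$ and $u$, a 2-sphere. When $z,u$ are represented by orthonormal vectors $\hat z,\hat u\in\mathbb{C}^4$ (as is the case for $p_+$ and $p_-$, which lie in $\{[\alpha,0,0,\beta]\}$ and $\{[0,\alpha,\beta,0]\}$ respectively), the equatorial circle (with $z,u$ as poles) is $C_{zu}=\{[\hat u+\tau\hat z]:\tau\in\mathbb{C},\ |\tau|=1\}$. *)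

(* Defs.v *)
From mathcomp Require Import all_boot all_order all_algebra.
From mathcomp Require Import spectral.
From mathcomp Require Import complex.
From mathcomp Require Import boolp classical_sets reals.

Set Implicit Arguments.
Unset Strict Implicit.
Unset Printing Implicit Defensive.

Import Order.TTheory GRing.Theory Num.Theory.

Local Open Scope classical_set_scope.
Local Open Scope ring_scope.

(* Conventions: a vector of g = su(2) x su(2) is the column of its coordinates
   in the basis e_1, ..., e_6, a (complex) covector is the row of its
   coordinates in the dual basis e^1, ..., e^6, and an endomorphism I of g is a
   6 x 6 matrix, with I X = I *m X. *)

(* The indices 1, ..., 6 of the text, as elements of {0, ..., 5}. *)
Definition ix (k : nat) : 'I_6 := inord k.-1.

Section LieAlgebra.
Variable R : realType.

Definition e (k : nat) : 'cV[R]_6 := delta_mx (ix k) 0.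

Definition g (X Y : 'cV[R]_6) : R := \sum_(i < 6) X i 0 * Y i 0.

(* e^i /\ e^j, normalised by (e^i /\ e^j)(e_i, e_j) = 1 for i <> j *)
Definition wedge (i j : nat) (X Y : 'cV[R]_6) : R :=
  X (ix i) 0 * Y (ix j) 0 - X (ix j) 0 * Y (ix i) 0.

(* The coefficient wedge i j X Y multiplies [e_i, e_j]: [e_1, e_2] = e_3,
   [e_1, e_3] = - e_2, [e_2, e_3] = e_1, and likewise for e_4, e_5, e_6. *)
Definition bracket (X Y : 'cV[R]_6) : 'cV[R]_6 :=
  wedge 1 2 X Y *: e 3 - wedge 1 3 X Y *: e 2 + wedge 2 3 X Y *: e 1
  + (wedge 4 5 X Y *: e 6 - wedge 4 6 X Y *: e 5 + wedge 5 6 X Y *: e 4).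

(* The matrix with columns X1, I X1, X2, I X2, X3, I X3. *)
Definition frame (I : 'M[R]_6) (X1 X2 X3 : 'cV[R]_6) : 'M[R]_6 :=
  \matrix_(i, j)
    tnth [tuple X1; I *m X1; X2; I *m X2; X3; I *m X3] j i 0.

Definition Z : set 'M[R]_6 := [set I |
  [/\ I *m I = - (1%:M),
      forall X Y, g (I *m X) (I *m Y) = g X Y &
      forall X1 X2 X3,
        frame I X1 X2 X3 \in unitmx -> 0 < \det (frame I X1 X2 X3)]].

Definition fundamental_form (I : 'M[R]_6) (X Y : 'cV[R]_6) : R :=
  g (I *m X) Y.

Definition nijenhuis (I : 'M[R]_6) (X Y : 'cV[R]_6) : 'cV[R]_6 :=
  bracket (I *m X) (I *m Y) - bracket X Y
  - I *m bracket X (I *m Y) - I *m bracket (I *m X) Y.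

Definition nijenhuis_norm2 (I : 'M[R]_6) : R :=
  \sum_(i < 6) \sum_(j < 6) \sum_(k < 6)
    (nijenhuis I (delta_mx i 0) (delta_mx j 0) k 0) ^+ 2.

Definition ANK : set 'M[R]_6 := [set I |
  Z I /\ forall J, Z J -> nijenhuis_norm2 J <= nijenhuis_norm2 I].

Definition omega_plus (r x u : R) (X Y : 'cV[R]_6) : R :=
  wedge 5 6 X Y + r * (wedge 1 2 X Y + wedge 3 4 X Y)
  + x * (wedge 1 3 X Y + wedge 4 2 X Y)
  + u * (wedge 1 4 X Y + wedge 2 3 X Y).

Definition omega_minus (r x u : R) (X Y : 'cV[R]_6) : R :=
  - wedge 5 6 X Y - r * (wedge 1 2 X Y - wedge 3 4 X Y)
  - x * (wedge 1 3 X Y - wedge 4 2 X Y)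
  + u * (wedge 1 4 X Y - wedge 2 3 X Y).

End LieAlgebra.

Arguments Z {R}.
Arguments ANK {R}.

Section ProjectiveSpace.
Variable R : realType.
Local Notation C := R[i].
Local Notation "''i'" := (Complex 0 1 : C).

Definition dual_e (k : nat) : 'rV[C]_6 := delta_mx 0 (ix k).

(* For w, v in V = C^4 (coordinates in v^0, ..., v^3), w /\ v as a complex
   covector: w /\ v is the sum of the p a b times v^a /\ v^b over the six pairs
   (a, b) below, where v^0 /\ v^1 = (e^1 + i e^2) / 2, etc. *)
Definition bivector (w v : 'rV[C]_4) : 'rV[C]_6 :=
  let p (a b : nat) :=
    w 0 (inord a) * v 0 (inord b) - w 0 (inord b) * v 0 (inord a) in
  p 0%N 1%N *: (2^-1 *: (dual_e 1 + 'i *: dual_e 2))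
  + p 2%N 3%N *: (2^-1 *: (dual_e 1 - 'i *: dual_e 2))
  + p 0%N 2%N *: (2^-1 *: (dual_e 3 + 'i *: dual_e 4))
  + p 3%N 1%N *: (2^-1 *: (dual_e 3 - 'i *: dual_e 4))
  + p 0%N 3%N *: (2^-1 *: (dual_e 5 + 'i *: dual_e 6))
  + p 1%N 2%N *: (2^-1 *: (dual_e 5 - 'i *: dual_e 6)).

(* The point [w] of P(V) corresponds to I in Z. Since (I alpha)(X) = alpha(I X),
   I maps the row alpha to alpha *m I, so the i-eigenspace of I on covectors is
   the row space of the library's eigenspace. *)
Definition represents (w : 'rV[C]_4) (I : 'M[R]_6) : Prop :=
  [/\ w != 0, Z I &
      forall theta : 'rV[C]_6,
        (theta <= eigenspace (map_mx (real_complex R) I) 'i)%MS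
        <-> exists v, theta = bivector w v].

(* The circle C_{zu}, for z, u having orthonormal representatives; it does not
   depend on the choice of these, which are unique up to phases. *)
Definition equator (z u : 'M[R]_6) : set 'M[R]_6 := [set I |
  exists zh uh : 'rV[C]_4,
    [/\ represents zh z, represents uh u,
        [/\ dotmx zh zh = 1, dotmx uh uh = 1 & dotmx zh uh = 0] &
        exists2 tau : C, `|tau| = 1 & represents (uh + tau *: zh) I]].

End ProjectiveSpace.

(* Main.v *)
Require Import Defs.
From mathcomp Require Import all_boot all_order all_algebra all_fingroup.
From mathcomp Require Import spectral complex ring lra.
From mathcomp Require Import boolp classical_sets reals.

Set Implicit Arguments.
Unset Strict Implicit.
Unset Printing Implicit Defensive.

Import Order.TTheory GRing.Theory Num.Theory.

Local Open Scope classical_set_scope.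
Local Open Scope ring_scope.

(** The metric [g] is bi-invariant, so [c(X, Y, U) = g([X, Y], U)] is the 3-form
    [e^123 + e^456], and for orthogonal [I] the tensor [g(N_I(X, Y), U)] is the
    cyclic sum of [c(IX, IY, U)] minus [c(X, Y, U)]. Expanding its square and
    moving [I] across the sums gives [|N_I|^2 = 48 - 24 s], where [s] is the sum of
    the squares of the entries of [I] above the diagonal in its two diagonal 3 x 3
    blocks. Hence [I] is maximally non-integrable iff these blocks vanish,
    i.e. [I = (0, B; - B^T, 0)] with [B] in SO(3), by the orientation.

    On the other side, twice the projection of a covector [theta] to [V_w] is
    [theta - i I theta], and the projection is a multiple of
    [w /\ (conj w _| theta)]. So [w] represents [I] iff [|w|^2 I] is an explicit
    matrix, quadratic in [w]. Both inclusions then become identities between the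
    real and imaginary parts of the coordinates of [w]; that every [B] in SO(3)
    occurs is its parametrisation by a unit quaternion [(a, b, c, d)], with
    [w = (a + ib, c + id, a - ib, - c + id)]. *)

(** * Indices as literal ordinals, on which matrix entries compute *)

Local Notation "''o' k" := (@Ordinal 6 k isT) (at level 8, k at level 2, format "''o' k").
Local Notation "''q' k" := (@Ordinal 4 k isT) (at level 8, k at level 2, format "''q' k").

Lemma ixE : ((ix 1 = 'o0) * (ix 2 = 'o1) * (ix 3 = 'o2) *
             (ix 4 = 'o3) * (ix 5 = 'o4) * (ix 6 = 'o5))%type.
Proof. by do !split; apply: val_inj; rewrite /ix /= inordK. Qed.

Lemma inord4E : ((inord 0 = 'q0) * (inord 1 = 'q1) *
                 (inord 2 = 'q2) * (inord 3 = 'q3))%type.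
Proof. by do !split; apply: val_inj; rewrite /= inordK. Qed.

Lemma forall_ord6 (P : 'I_6 -> Prop) :
  P 'o0 -> P 'o1 -> P 'o2 -> P 'o3 -> P 'o4 -> P 'o5 -> forall i, P i.
Proof.
move=> P0 P1 P2 P3 P4 P5 [[|[|[|[|[|[|//]]]]]] i6];
by rewrite (bool_irrelevance i6 isT).
Qed.

Lemma forall_ord4 (P : 'I_4 -> Prop) :
  P 'q0 -> P 'q1 -> P 'q2 -> P 'q3 -> forall i, P i.
Proof.
move=> P0 P1 P2 P3 [[|[|[|[|//]]]] i4];
by rewrite (bool_irrelevance i4 isT).
Qed.

Lemma sum_ord6 (V : nmodType) (F : 'I_6 -> V) :
  \sum_(i < 6) F i = F 'o0 + F 'o1 + F 'o2 + F 'o3 + F 'o4 + F 'o5.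
Proof.
rewrite !big_ord_recl big_ord0 addr0 !addrA.
by do !congr (_ + _); congr F; apply: val_inj.
Qed.

Lemma sum_ord4 (V : nmodType) (F : 'I_4 -> V) :
  \sum_(i < 4) F i = F 'q0 + F 'q1 + F 'q2 + F 'q3.
Proof.
rewrite !big_ord_recl big_ord0 addr0 !addrA.
by do !congr (_ + _); congr F; apply: val_inj.
Qed.

(** * The norm of the Nijenhuis tensor *)

Section Norm.
Variable R : realType.
Implicit Types (I : 'M[R]_6) (X Y U V : 'cV[R]_6).
Local Notation E i := (delta_mx i 0 : 'cV[R]_6).

Definition cartan3 X Y U : R := g (bracket X Y) U.

Lemma cartan3E X Y U : cartan3 X Y U =
  (X 'o0 0 * Y 'o1 0 - X 'o1 0 * Y 'o0 0) * U 'o2 0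
  - (X 'o0 0 * Y 'o2 0 - X 'o2 0 * Y 'o0 0) * U 'o1 0
  + (X 'o1 0 * Y 'o2 0 - X 'o2 0 * Y 'o1 0) * U 'o0 0
  + (X 'o3 0 * Y 'o4 0 - X 'o4 0 * Y 'o3 0) * U 'o5 0
  - (X 'o3 0 * Y 'o5 0 - X 'o5 0 * Y 'o3 0) * U 'o4 0
  + (X 'o4 0 * Y 'o5 0 - X 'o5 0 * Y 'o4 0) * U 'o3 0.
Proof.
rewrite /cartan3 /g sum_ord6 /bracket /wedge /e !ixE !mxE /=.
ring.
Qed.

Lemma cartan3_rot X Y U : cartan3 X Y U = cartan3 Y U X.
Proof. by rewrite !cartan3E; ring. Qed.

Lemma g_sym X Y : g X Y = g Y X.
Proof. by rewrite /g; apply: eq_bigr => i _; rewrite mulrC. Qed.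

Lemma gDl X Y U : g (X + Y) U = g X U + g Y U.
Proof. by rewrite /g -big_split; apply: eq_bigr => i _; rewrite mxE mulrDl. Qed.

Lemma gNl X U : g (- X) U = - g X U.
Proof. by rewrite /g -sumrN; apply: eq_bigr => i _; rewrite mxE mulNr. Qed.

Lemma gE i X : g X (E i) = X i 0.
Proof.
rewrite /g (bigD1 i) //= big1 ?addr0 => [|j ji]; rewrite mxE ?eqxx ?mulr1 //.
by rewrite (negbTE ji) mulr0.
Qed.

Lemma g_parseval X Y : \sum_i g X (E i) * g Y (E i) = g X Y.
Proof. by apply: eq_bigr => i _; rewrite !gE. Qed.

Section Skew.
Variable I : 'M[R]_6.
Hypothesis ZI : Z I.

Lemma Z_sq X : I *m (I *m X) = - X.
Proof. by case: ZI => I2 _ _; rewrite mulmxA I2 mulNmx mul1mx. Qed.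

Lemma Z_adj X Y : g (I *m X) Y = - g X (I *m Y).
Proof.
by case: (ZI) => _ gI _; rewrite -gI Z_sq gNl.
Qed.

Lemma Z_skew i j : I i j = - I j i.
Proof.
have := Z_adj (E j) (E i); rewrite g_sym (g_sym (E j)) (g_sym (E i)) !gE.
by rewrite -!colE !mxE.
Qed.

(** Since [I] is orthogonal, the vectors [I *m E i] form another orthonormal basis, and both sides
    are [g X Y]. *)
Lemma sum_orth X Y :
  \sum_i g X (I *m E i) * g Y (I *m E i) = \sum_i g X (E i) * g Y (E i).
Proof.
rewrite [RHS]g_parseval; case: ZI => _ <- _; rewrite -g_parseval.
by apply: eq_bigr => i _; rewrite !Z_adj mulrNN.
Qed.

(** Both sides are [- g X (I *m Y)], by Parseval and the skewness of [I]. *)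
Lemma sum_skew X Y :
  \sum_i g X (E i) * g Y (I *m E i) = - \sum_i g X (I *m E i) * g Y (E i).
Proof.
under eq_bigr do rewrite -(opprK (g Y _)) -Z_adj mulrN.
rewrite sumrN g_parseval; congr (- _).
under [RHS]eq_bigr do rewrite -(opprK (g X _)) -Z_adj mulNr.
by rewrite sumrN g_parseval Z_adj opprK.
Qed.

Local Notation T i j k := (cartan3 (I *m E i) (I *m E j) (E k)).

Lemma sum3_rot (F : 'I_6 -> 'I_6 -> 'I_6 -> R) :
  \sum_i \sum_j \sum_k F j k i = \sum_i \sum_j \sum_k F i j k.
Proof.
rewrite exchange_big; apply: eq_bigr => i _; rewrite exchange_big //.
Qed.

(** Skewness moves the outer [I] of [I [X, IY]] and [I [IX, Y]] onto [E k]; cyclic invariance of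
    [cartan3] then turns both into values of [T]. *)
Lemma nijenhuisE i j k :
  nijenhuis I (E i) (E j) k 0 = T i j k + T j k i + T k i j - cartan3 (E i) (E j) (E k).
Proof.
rewrite -gE /nijenhuis 3!gDl 3!gNl -!/(cartan3 _ _ _) !Z_adj -!/(cartan3 _ _ _).
rewrite (cartan3_rot (E i) (I *m _)) -(cartan3_rot (I *m E k)) opprK.
ring.
Qed.

Local Notation C i j k := (cartan3 (E i) (E j) (E k)).
(** All cross terms of the squared norm reduce to this number. *)
Definition cartan_contraction := \sum_i \sum_j \sum_k T i j k * C i j k.

(** Summing over one index at a time, [sum_orth] strips [I] from the first argument, then from the
    second. *)
Lemma sum_sqr_cartan3_orth : \sum_i \sum_j \sum_k T i j k ^+ 2 = \sum_i \sum_j \sum_k C i j k ^+ 2.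
Proof.
transitivity (\sum_j \sum_k \sum_i T i j k ^+ 2).
  exact: (sum3_rot (fun j k i => T i j k ^+ 2)).
transitivity (\sum_j \sum_k \sum_i cartan3 (E i) (I *m E j) (E k) ^+ 2).
  apply: eq_bigr => j _; apply: eq_bigr => k _.
  under eq_bigr do rewrite cartan3_rot expr2; under [RHS]eq_bigr do rewrite cartan3_rot expr2.
  exact: sum_orth.
rewrite -(sum3_rot (fun j k i => cartan3 (E i) (I *m E j) (E k) ^+ 2)).
apply: eq_bigr => i _; rewrite exchange_big [RHS]exchange_big /=.
apply: eq_bigr => k _.
under eq_bigr do rewrite -cartan3_rot expr2; under [RHS]eq_bigr do rewrite -cartan3_rot expr2.
exact: sum_orth.
Qed.

(** Both factors contain [I *m E k], and [sum_orth] over [k] removes this [I]. Then [sum_skew] over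
    [i] carries the [I] on [E i] over to the other factor, which gives the sign. *)
Lemma sum_mul_cartan3_rot : \sum_i \sum_j \sum_k T j k i * T k i j = - cartan_contraction.
Proof.
rewrite /cartan_contraction.
transitivity (\sum_i \sum_j \sum_k cartan3 (E i) (I *m E j) (E k) * cartan3 (I *m E i) (E j) (E k)).
  apply: eq_bigr => i _; apply: eq_bigr => j _.
  under eq_bigr => k _ do rewrite -(cartan3_rot (E i)) (cartan3_rot (I *m E k)).
  rewrite /cartan3; exact: sum_orth.
rewrite (sum3_rot (fun j k i => cartan3 (E i) (I *m E j) (E k) * cartan3 (I *m E i) (E j) (E k))).
rewrite (sum3_rot (fun j k i => T i j k * C i j k)) -sumrN.
apply: eq_bigr => j _; rewrite -sumrN; apply: eq_bigr => k _.
under eq_bigr => i _ do rewrite (cartan3_rot (E i)) (cartan3_rot (I *m E i)).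
under [in RHS]eq_bigr => i _ do rewrite (cartan3_rot (E i)) (cartan3_rot (I *m E i)).
exact: sum_skew.
Qed.

(** The six nonzero brackets of basis vectors are, up to sign, the orthonormal basis itself, so the
    inner product of two brackets is a sum over six planes. *)
Lemma cartan3_bracket X Y U V : cartan3 X Y (bracket U V) =
  wedge 1 2 X Y * wedge 1 2 U V + wedge 1 3 X Y * wedge 1 3 U V
  + wedge 2 3 X Y * wedge 2 3 U V + wedge 4 5 X Y * wedge 4 5 U V
  + wedge 4 6 X Y * wedge 4 6 U V + wedge 5 6 X Y * wedge 5 6 U V.
Proof. by rewrite cartan3E /bracket /wedge /e !ixE !mxE /=; ring. Qed.

(** Only [(ix a, ix b)] and [(ix b, ix a)] contribute, and each gives the principal minor of [A] on
    these two indices. *)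
Lemma sum_wedge (A : 'M[R]_6) a b : ix a != ix b ->
  \sum_i \sum_j wedge a b (A *m E i) (A *m E j) * wedge a b (E i) (E j) =
  2 * (A (ix a) (ix a) * A (ix b) (ix b) - A (ix a) (ix b) * A (ix b) (ix a)).
Proof.
move=> ab; rewrite (bigD1 (ix a)) //= [X in _ + X](bigD1 (ix b)) 1?eq_sym //=.
rewrite [X in _ + (_ + X)]big1 ?addr0 => [|i /andP[ia ib]]; last first.
  apply: big1 => j _; rewrite /wedge !mxE !(eq_sym (ix _) i).
  by rewrite (negbTE ia) (negbTE ib) !mul0r subrr mulr0.
rewrite (bigD1 (ix b)) //= big1 ?addr0 => [|j jb]; last first.
  rewrite /wedge !mxE (eq_sym (ix b) j) (negbTE jb).
  by rewrite (eq_sym _ (ix a)) (negbTE ab) mulr0 mul0r subrr mulr0.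
rewrite (bigD1 (ix a)) //= big1 ?addr0 => [|j ja]; last first.
  rewrite /wedge !mxE (negbTE ab) (eq_sym (ix a) j) (negbTE ja).
  by rewrite mulr0 mul0r subrr mulr0.
rewrite /wedge -!colE !mxE !eqxx (negbTE ab) eq_sym (negbTE ab) /=.
ring.
Qed.

Lemma ix_neq : ((ix 1 != ix 2) * (ix 1 != ix 3) * (ix 2 != ix 3) *
                (ix 4 != ix 5) * (ix 4 != ix 6) * (ix 5 != ix 6))%type.
Proof. by rewrite !ixE. Qed.

Lemma sum_sqr_cartan3 : \sum_i \sum_j \sum_k C i j k ^+ 2 = 12.
Proof.
under eq_bigr do under eq_bigr do under eq_bigr do rewrite expr2.
(* The identity matrix is inserted so that [sum_wedge] applies with [A = 1]; each of the six planes
   then gives 2. *)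
under eq_bigr => i _ do under eq_bigr => j _ do
  rewrite g_parseval -/(cartan3 _ _ _) -[X in cartan3 X _ _]mul1mx
          -[X in cartan3 _ X _]mul1mx cartan3_bracket.
under eq_bigr do rewrite !big_split.
by rewrite !big_split /= !sum_wedge ?ix_neq // !ixE !mxE /=; ring.
Qed.

(** For skew [I] the principal minor on two indices is the square of the off-diagonal entry. *)
Lemma cartan_contractionE : cartan_contraction = 2 * (I 'o0 'o1 ^+ 2 + I 'o0 'o2 ^+ 2 + I 'o1 'o2 ^+ 2
                      + I 'o3 'o4 ^+ 2 + I 'o3 'o5 ^+ 2 + I 'o4 'o5 ^+ 2).
Proof.
rewrite /cartan_contraction; under eq_bigr do under eq_bigr do
  rewrite g_parseval -/(cartan3 _ _ _) cartan3_bracket.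
under eq_bigr do rewrite !big_split.
have I0 i : I i i = 0 by have := Z_skew i i; lra.
rewrite !big_split /= !sum_wedge ?ix_neq // !ixE !I0.
rewrite (Z_skew 'o1 'o0) (Z_skew 'o2 'o0) (Z_skew 'o2 'o1).
rewrite (Z_skew 'o4 'o3) (Z_skew 'o5 'o3) (Z_skew 'o5 'o4).
ring.
Qed.

(** With [K = cartan_contraction], the four squares give [4 * 12], the products of two values of [T]
    give [- 6 K], those of [T] with [C] give [- 6 K], and [K] is twice the sum in parentheses. *)
Lemma nijenhuis_norm2E : nijenhuis_norm2 I =
  48 - 24 * (I 'o0 'o1 ^+ 2 + I 'o0 'o2 ^+ 2 + I 'o1 'o2 ^+ 2
             + I 'o3 'o4 ^+ 2 + I 'o3 'o5 ^+ 2 + I 'o4 'o5 ^+ 2).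
Proof.
pose S (F : 'I_6 -> 'I_6 -> 'I_6 -> R) := \sum_i \sum_j \sum_k F i j k.
have SD F G : S (fun i j k => F i j k + G i j k) = S F + S G.
  rewrite /S -big_split; apply: eq_bigr => i _; rewrite -big_split.
  by apply: eq_bigr => j _; rewrite -big_split.
have SZ a F : S (fun i j k => a * F i j k) = a * S F.
  rewrite /S mulr_sumr; apply: eq_bigr => i _; rewrite mulr_sumr.
  by apply: eq_bigr => j _; rewrite mulr_sumr.
have Srot F : S (fun i j k => F j k i) = S F by exact: sum3_rot.
have Srot2 F : S (fun i j k => F k i j) = S F.
  by rewrite -(Srot (fun i j k => F k i j)).
pose t i j k := T i j k; pose c i j k := C i j k.
have cr i j k : c j k i = c i j k by rewrite /c -cartan3_rot.
have -> : nijenhuis_norm2 I = S (fun i j k =>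
    (t i j k ^+ 2 + t j k i ^+ 2 + t k i j ^+ 2 + c i j k ^+ 2)
    + 2 * (t j k i * t k i j + t k i j * t i j k + t i j k * t j k i)
    + - 2 * (t i j k * c i j k + t j k i * c j k i + t k i j * c k i j)).
  rewrite /nijenhuis_norm2 /S.
  apply: eq_bigr => i _; apply: eq_bigr => j _; apply: eq_bigr => k _.
  rewrite nijenhuisE -/(t _ _ _) -/(t j k i) -/(t k i j) -/(c _ _ _).
  rewrite (cr i j k) -(cr k i j); ring.
rewrite !(SD, SZ).
rewrite (Srot (fun i j k => t i j k ^+ 2)) (Srot2 (fun i j k => t i j k ^+ 2)).
rewrite (Srot (fun i j k => t j k i * t k i j)).
rewrite (Srot2 (fun i j k => t j k i * t k i j)).
rewrite (Srot (fun i j k => t i j k * c i j k)).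
rewrite (Srot2 (fun i j k => t i j k * c i j k)).
have -> : S (fun i j k => t i j k ^+ 2) = 12 by rewrite /S sum_sqr_cartan3_orth sum_sqr_cartan3.
have -> : S (fun i j k => c i j k ^+ 2) = 12 by rewrite /S sum_sqr_cartan3.
have -> : S (fun i j k => t j k i * t k i j) = - cartan_contraction by exact: sum_mul_cartan3_rot.
have -> : S (fun i j k => t i j k * c i j k) = cartan_contraction by [].
by rewrite cartan_contractionE; ring.
Qed.

End Skew.
End Norm.

(** * Orientation of the frames of a complex structure *)

Section Orientation.
Variable R : realType.

(** This is the real form of the complex matrix [H = A + i B], so its determinant is [|det H|^2]:
    conjugation by the unipotent [P], with inverse [Q], makes it block triangular with diagonal
    [conj H], [H]. *)
Lemma det_complex_ge0 n (A B : 'M[R]_n) :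
  0 <= \det (block_mx A B (- B) A).
Proof.
pose i := (Complex 0 1 : R[i]); have ii : i * i = -1 by rewrite -expr2 sqr_i.
pose f := real_complex R; pose c := @conjc R.
pose P := block_mx (1%:M : 'M[R[i]]_n) 0 (i%:M) (1%:M : 'M_n).
pose Q := block_mx (1%:M : 'M[R[i]]_n) 0 (- i%:M) (1%:M : 'M_n).
pose H := map_mx f A + i *: map_mx f B.
have detP : \det P = 1 by rewrite det_lblock !det1 mulr1.
have detQ : \det Q = 1 by rewrite det_lblock !det1 mulr1.
have Hc : map_mx c H = map_mx f A - i *: map_mx f B.
  apply/matrixP=> j k; rewrite !mxE /c /f rmorphD rmorphM /= ?oppr0.
  by apply/eqP; rewrite eq_complex /=; apply/andP; split; apply/eqP; ring.
have E : P *m map_mx f (block_mx A B (- B) A) *m Q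
         = block_mx (map_mx c H) (map_mx f B) 0 H.
  rewrite map_block_mx map_mxN !mulmx_block !mul1mx !mulmx1 !mul0mx !mulmx0.
  rewrite !mul_scalar_mx !mulmxN !mul_mx_scalar Hc !addr0 add0r.
  congr block_mx; last by rewrite add0r addrC.
  by rewrite scalerDr scalerA ii scaleN1r [X in _ - X]addrC subrr.
have := congr1 determinant E; rewrite !det_mulmx detP detQ mul1r mulr1.
rewrite det_ublock !det_map_mx => D.
rewrite -ler0c; apply: (@le_trans _ _ (\det H * conjc (\det H))).
  exact: mulcJ_ge0.
by rewrite mulrC -D.
Qed.

(** If [F] is invertible, [G = F K] with [K] commuting with [J]. Hence [K] has the shape of
    [det_complex_ge0], and the product is [(det F)^2 det K]. *)
Lemma det_frames_ge0 (I : 'M[R]_6) (F G : 'M[R]_(3 + 3)) :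
  I *m I = - 1%:M -> rsubmx F = I *m lsubmx F -> rsubmx G = I *m lsubmx G ->
  0 <= \det F * \det G.
Proof.
move=> I2 FI GI.
have [->|F0] := eqVneq (\det F) 0; first by rewrite mul0r.
pose J := block_mx 0 (- 1%:M) (1%:M) 0 : 'M[R]_(3 + 3).
have frameJ (H : 'M[R]_(3 + 3)) : rsubmx H = I *m lsubmx H -> I *m H = H *m J.
  move=> HI; rewrite -[H]hsubmxK HI mul_mx_row mulmxA I2 mulNmx mul1mx.
  by rewrite mul_row_block !mulmx0 mulmx1 mulmxN mulmx1 add0r addr0.
have Fu : F \in unitmx by rewrite unitmxE unitfE.
have [K FK] : exists K, F *m K = G by exists (invmx F *m G); rewrite mulKVmx.
have JK : J *m K = K *m J.
  rewrite -[LHS](mulKmx Fu) -[RHS](mulKmx Fu); congr (_ *m _).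
  rewrite [LHS]mulmxA -(frameJ F) //.
  rewrite -[LHS]mulmxA FK [RHS]mulmxA FK; exact: frameJ.
have : 0 <= \det K.
  move: JK; rewrite -[K]submxK /J !mulmx_block !mul0mx !mulmx0 !mul1mx !mulmx1.
  rewrite !mulNmx !mulmxN !mul1mx !mulmx1 !add0r !addr0.
  case/eq_block_mx=> E1 _ E3 _.
  rewrite -E3 (_ : dlsubmx K = - ursubmx K) -?E1 ?opprK //.
  by have := det_complex_ge0 (ulsubmx K) (ursubmx K); rewrite -E1 opprK.
move=> K0; rewrite -FK det_mulmx mulrA -expr2.
by apply: mulr_ge0 => //; apply: sqr_ge0.
Qed.

(** Gathering the [X]s before the [I X]s takes three transpositions of columns, hence the sign. *)
Lemma det_frame (I : 'M[R]_6) (F : 'M[R]_(3 + 3)) X1 X2 X3 :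
  F = \matrix_(i, j) tnth [tuple X1; X2; X3; I *m X1; I *m X2; I *m X3] j i 0 ->
  \det (frame I X1 X2 X3) = - \det F /\ rsubmx F = I *m lsubmx F.
Proof.
move=> FE; split; last first.
  apply/matrixP=> i j; rewrite !mxE FE !mxE.
  transitivity ((I *m tnth [tuple X1; X2; X3] j) i 0).
    rewrite !(tnth_nth 0); case: j => [[|[|[|//]]] /= _]; by [].
  rewrite mxE; apply: eq_bigr => k _; rewrite !mxE; congr (_ * _).
  by rewrite !(tnth_nth 0); case: j => [[|[|[|//]]] /= _].
have -> : frame I X1 X2 X3 = xcol 'o1 'o2 (xcol 'o2 'o3 (xcol 'o2 'o4 F)).
  apply/matrixP=> i; apply: forall_ord6;
  by rewrite !mxE !permE /= FE mxE !(tnth_nth 0) /= ?mxE.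
by rewrite !xcolE !det_mulmx !det_perm !odd_tperm /= !expr1 !mulrN1 !opprK.
Qed.

(** By [det_frames_ge0] all bases of this shape have the same orientation, so one positive frame is
    enough. *)
Lemma Z_of_frame (I : 'M[R]_6) Y1 Y2 Y3 :
  I *m I = - 1%:M -> (forall i j, I i j = - I j i) ->
  0 < \det (frame I Y1 Y2 Y3) -> Z I.
Proof.
move=> I2 skewI posY; split => // [X Y|X1 X2 X3].
  have IT : I^T = - I by apply/matrixP=> i j; rewrite !mxE skewI.
  have gE (U V : 'cV[R]_6) : g U V = (U^T *m V) 0 0.
    by rewrite mxE; apply: eq_bigr => i _; rewrite mxE.
  by rewrite !gE trmx_mul IT mulmxA -(mulmxA _ (- I)) mulNmx I2 opprK mulmx1.
rewrite unitmxE unitfE lt0r => -> /=.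
have [eY FY] := det_frame (erefl
  (\matrix_(i, j) tnth [tuple Y1; Y2; Y3; I *m Y1; I *m Y2; I *m Y3] j i 0)).
have [eX FX] := det_frame (erefl
  (\matrix_(i, j) tnth [tuple X1; X2; X3; I *m X1; I *m X2; I *m X3] j i 0)).
have := det_frames_ge0 I2 FY FX.
by rewrite -mulrNN -eY -eX pmulr_rge0.
Qed.

Lemma frame_ge0 (I : 'M[R]_6) X1 X2 X3 : Z I -> 0 <= \det (frame I X1 X2 X3).
Proof.
case=> _ _ pos; have [->//|d0] := eqVneq (\det (frame I X1 X2 X3)) 0.
by apply/ltW/pos; rewrite unitmxE unitfE.
Qed.
End Orientation.

(** * Determinants of matrices given by lists of rows *)

Section Det.
Variable R : comNzRingType.

(** Laplace expansion along a row, written on lists so that [/=] turns a concrete determinant into a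
    polynomial. [sg] is the sign of the current term, [k] its column and [f k] the corresponding
    minor. *)
Fixpoint rowsum (n : nat) (sg : bool) (k : nat) (r : seq R) (f : nat -> R) : R :=
  if n is n'.+1 then
    (if sg then - (head 0 r * f k) else head 0 r * f k)
    + rowsum n' (~~ sg) k.+1 (behead r) f
  else 0.

Fixpoint detseq (n : nat) (s : seq (seq R)) : R :=
  if n is n'.+1 then
    rowsum n false 0 (head [::] s)
      (fun k => detseq n' [seq take k r ++ drop k.+1 r | r <- behead s])
  else 1.

Definition mxseq n (s : seq (seq R)) : 'M[R]_n :=
  \matrix_(i, j) nth 0 (nth [::] s i) j.

Lemma rowsumE n sg k r f :
  rowsum n sg k r f = \sum_(i < n) (-1) ^+ (sg + i) * nth 0 r i * f (k + i)%N.
Proof.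
elim: n sg k r => [|n IHn] sg k r /=; first by rewrite big_ord0.
rewrite big_ord_recl IHn nth0 addn0; congr (_ + _).
  by case: sg; rewrite /= addn0 ?expr1 ?expr0 ?mulN1r ?mul1r ?mulNr.
apply: eq_bigr => i _; rewrite nth_behead lift0 addSnnS.
congr (_ * _ * _); rewrite addnS exprS.
by case: sg => /=; rewrite ?add0n ?add1n ?exprS ?mulN1r ?opprK.
Qed.

Lemma nth_take_drop (r : seq R) j b :
  nth 0 (take j r ++ drop j.+1 r) b = nth 0 r (bump j b).
Proof.
rewrite nth_cat size_take /bump; have [jr|rj] := ltnP j (size r).
  have [bj|jb] := ltnP b j; first by rewrite nth_take.
  by rewrite nth_drop add1n addSn subnKC.
rewrite take_oversize // drop_oversize ?(leq_trans rj) // nth_nil.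
have [br|rb] := ltnP b (size r); last by rewrite nth_default ?(leq_trans rb) ?leq_addl.
by rewrite leqNgt (leq_trans br).
Qed.

Lemma detseqS n s : detseq n.+1 s = rowsum n.+1 false 0 (head [::] s)
  (fun k => detseq n [seq take k r ++ drop k.+1 r | r <- behead s]).
Proof. by []. Qed.

Lemma det_mxseq n s : \det (mxseq n s) = detseq n s.
Proof.
elim: n s => [|n IHn] s; first by rewrite det_mx00.
rewrite (expand_det_row _ ord0) detseqS rowsumE; apply: eq_bigr => j _.
rewrite mxE nth0 /cofactor mulrCA mulrA; congr (_ * _).
rewrite add0n -IHn; congr determinant; apply/matrixP=> a b; rewrite !mxE /=.
rewrite [bump 0 a]add1n -nth_behead -nth_take_drop.
have [as_|sa] := ltnP a (size (behead s)).
  by rewrite (nth_map [::]).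
by rewrite !(nth_default [::]) ?size_map.
Qed.
End Det.

(** * Skew matrices, fundamental forms and the poles *)

Section Skew6.
Variable R : realType.
Local Notation E i := (delta_mx i 0 : 'cV[R]_6).

Definition skew6 (a12 a13 a14 a15 a16 a23 a24 a25 a26 a34 a35 a36 a45 a46 a56 : R) :
    'M[R]_6 :=
  mxseq 6 [:: [:: 0; a12; a13; a14; a15; a16];
              [:: - a12; 0; a23; a24; a25; a26];
              [:: - a13; - a23; 0; a34; a35; a36];
              [:: - a14; - a24; - a34; 0; a45; a46];
              [:: - a15; - a25; - a35; - a45; 0; a56];
              [:: - a16; - a26; - a36; - a46; - a56; 0]].

Lemma skew6_skew a12 a13 a14 a15 a16 a23 a24 a25 a26 a34 a35 a36 a45 a46 a56 i j :
  skew6 a12 a13 a14 a15 a16 a23 a24 a25 a26 a34 a35 a36 a45 a46 a56 i j =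
  - skew6 a12 a13 a14 a15 a16 a23 a24 a25 a26 a34 a35 a36 a45 a46 a56 j i.
Proof. by move: i j; do 2!apply: forall_ord6; rewrite !mxE /= ?opprK ?oppr0. Qed.

Lemma skew6E (A : 'M[R]_6) : (forall i j, A i j = - A j i) ->
  A = skew6 (A 'o0 'o1) (A 'o0 'o2) (A 'o0 'o3) (A 'o0 'o4) (A 'o0 'o5)
        (A 'o1 'o2) (A 'o1 'o3) (A 'o1 'o4) (A 'o1 'o5)
        (A 'o2 'o3) (A 'o2 'o4) (A 'o2 'o5) (A 'o3 'o4) (A 'o3 'o5) (A 'o4 'o5).
Proof.
move=> sA; have A0 i : A i i = 0 by have := sA i i; lra.
by apply/matrixP; do 2!apply: forall_ord6; rewrite mxE /= ?A0.
Qed.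

Lemma frame_delta (A : 'M[R]_6) a b c : frame A (E a) (E b) (E c) =
  mxseq 6 [seq [:: (i == a)%:R; A i a; (i == b)%:R; A i b; (i == c)%:R; A i c]
          | i <- [:: 'o0; 'o1; 'o2; 'o3; 'o4; 'o5]].
Proof.
apply/matrixP; do 2!apply: forall_ord6;
  by rewrite [LHS]mxE (tnth_nth 0) /= -?colE !mxE /= ?andbT.
Qed.

(** For [A = (0, B; - B^T, D)] this is [det B]: the sign of [- B^T] cancels that of the reordering
    of columns. *)
Lemma det_frame_blocks (A : 'M[R]_6) : (forall i j, A i j = - A j i) ->
  A 'o0 'o1 = 0 -> A 'o0 'o2 = 0 -> A 'o1 'o2 = 0 ->
  \det (frame A (E 'o0) (E 'o1) (E 'o2)) =
    A 'o0 'o3 * (A 'o1 'o4 * A 'o2 'o5 - A 'o1 'o5 * A 'o2 'o4)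
    - A 'o0 'o4 * (A 'o1 'o3 * A 'o2 'o5 - A 'o1 'o5 * A 'o2 'o3)
    + A 'o0 'o5 * (A 'o1 'o3 * A 'o2 'o4 - A 'o1 'o4 * A 'o2 'o3).
Proof.
move=> sA A01 A02 A12; have A0 i : A i i = 0 by have := sA i i; lra.
rewrite frame_delta /= !A0 A01 A02 A12 (sA 'o1 'o0) (sA 'o2 'o0) (sA 'o2 'o1).
rewrite A01 A02 A12 !(sA 'o3) !(sA 'o4) !(sA 'o5) det_mxseq /=.
ring.
Qed.

(** On [e_1, ..., e_4] the form is self-dual for [s = 1] and anti-self-dual for [s = -1]. Signs are
    opposite to those of the 2-form because entry [(i, j)] is the form at [(e_j, e_i)]. *)
Definition polemx (s r x u : R) : 'M[R]_6 :=
  skew6 (- r) (- x) (- u) 0 0 (- (s * u)) (s * x) 0 0 (- (s * r)) 0 0 0 0 (- s).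

Lemma Z_polemx s r x u : s ^+ 2 = 1 -> r ^+ 2 + x ^+ 2 + u ^+ 2 = 1 -> Z (polemx s r x u).
Proof.
move=> s2 n1.
have P2 : polemx s r x u *m polemx s r x u = - 1%:M.
  have s1 : (s == 1) || (s == -1) by rewrite -eqf_sqr s2 expr1n.
  case/orP: s1 => /eqP->; apply/matrixP; do 2!apply: forall_ord6;
  rewrite !mxE sum_ord6 !mxE /=; lra.
have d1 : \det (frame (polemx s r x u) (E 'o0) (E 'o2) (E 'o4)) = s ^+ 2 * (r ^+ 2 + u ^+ 2).
  by rewrite frame_delta /= !mxE /= det_mxseq /=; ring.
have d2 : \det (frame (polemx s r x u) (E 'o0) (E 'o1) (E 'o4)) = s ^+ 2 * (x ^+ 2 + u ^+ 2).
  by rewrite frame_delta /= !mxE /= det_mxseq /=; ring.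
have sP i j : polemx s r x u i j = - polemx s r x u j i by exact: skew6_skew.
(* The first frame degenerates when [r = u = 0], as [I e_1] is then a multiple of [e_3]; in that
   case [x ^+ 2 = 1] and [e_2] replaces [e_3]. *)
have [ru|ru] := ltP 0 (r ^+ 2 + u ^+ 2).
  by apply: (@Z_of_frame _ _ (E 'o0) (E 'o2) (E 'o4) P2 sP); rewrite d1 s2 mul1r.
apply: (@Z_of_frame _ _ (E 'o0) (E 'o1) (E 'o4) P2 sP); rewrite d2 s2 mul1r.
by have := sqr_ge0 u; lra.
Qed.

Lemma entry_fundamental_form (A : 'M[R]_6) (w : 'cV[R]_6 -> 'cV[R]_6 -> R) :
  fundamental_form A = w -> forall i j, A j i = w (E i) (E j).
Proof. by move=> <- i j; rewrite /fundamental_form gE -colE mxE. Qed.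

Lemma fundamental_form_mx (A : 'M[R]_6) X Y :
  fundamental_form A X Y = \sum_i (\sum_j A i j * X j 0) * Y i 0.
Proof. by apply: eq_bigr => i _; rewrite mxE. Qed.

Lemma fundamental_form_polemx_plus r x u : fundamental_form (polemx 1 r x u) = omega_plus r x u.
Proof.
apply: funext => X; apply: funext => Y.
rewrite fundamental_form_mx !sum_ord6 !mxE /= /omega_plus /wedge !ixE; ring.
Qed.

Lemma fundamental_form_polemx_minus r x u :
  fundamental_form (polemx (-1) (- r) (- x) u) = omega_minus r x u.
Proof.
apply: funext => X; apply: funext => Y.
rewrite fundamental_form_mx !sum_ord6 !mxE /= /omega_minus /wedge !ixE; ring.
Qed.

Lemma fundamental_form_inj (A B : 'M[R]_6) :
  fundamental_form A = fundamental_form B -> A = B.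
Proof.
move/entry_fundamental_form=> AB; apply/matrixP=> i j.
by rewrite AB -(entry_fundamental_form (erefl _)).
Qed.

End Skew6.

(** * The structure attached to a point of CP^3 *)

Lemma combination_entries (K : comNzRingType) (t h j p01 p23 p02 p31 p03 p12 : K) :
  t * h = 1 ->
  t *: (p01 *: (h *: (delta_mx 0 'o0 + j *: delta_mx 0 'o1))
  + p23 *: (h *: (delta_mx 0 'o0 - j *: delta_mx 0 'o1))
  + p02 *: (h *: (delta_mx 0 'o2 + j *: delta_mx 0 'o3))
  + p31 *: (h *: (delta_mx 0 'o2 - j *: delta_mx 0 'o3))
  + p03 *: (h *: (delta_mx 0 'o4 + j *: delta_mx 0 'o5))
  + p12 *: (h *: (delta_mx 0 'o4 - j *: delta_mx 0 'o5))) =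
  \row_(k < 6) nth 0 [:: p01 + p23; j * (p01 - p23); p02 + p31; j * (p02 - p31);
        p03 + p12; j * (p03 - p12)] k.
Proof.
move=> th; apply/rowP; apply: forall_ord6; rewrite !mxE /=;
rewrite -[RHS]mul1r -[X in _ = X * _]th; ring.
Qed.

Section Projective.
Variable R : realType.
Local Notation C := R[i].
Local Notation Re := (@complex.Re R).
Local Notation Im := (@complex.Im R).
Local Notation i := (Complex 0 1 : C).

(** Left unnormalised, so that the entries are polynomials; they are the ones that make
    [bivector_contract] hold. *)
Definition pointmx (w : 'rV[C]_4) : 'M[R]_6 :=
  let x0 := Re (w 0 'q0) in let y0 := Im (w 0 'q0) in
  let x1 := Re (w 0 'q1) in let y1 := Im (w 0 'q1) in
  let x2 := Re (w 0 'q2) in let y2 := Im (w 0 'q2) in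
  let x3 := Re (w 0 'q3) in let y3 := Im (w 0 'q3) in
  skew6
    (- x0 ^+ 2 - x1 ^+ 2 + x2 ^+ 2 + x3 ^+ 2 - y0 ^+ 2 - y1 ^+ 2 + y2 ^+ 2 + y3 ^+ 2)
    (- 2 * x0 * y3 - 2 * x1 * y2 + 2 * x2 * y1 + 2 * x3 * y0)
    (2 * x0 * x3 - 2 * x1 * x2 + 2 * y0 * y3 - 2 * y1 * y2)
    (2 * x0 * y2 - 2 * x1 * y3 - 2 * x2 * y0 + 2 * x3 * y1)
    (- 2 * x0 * x2 - 2 * x1 * x3 - 2 * y0 * y2 - 2 * y1 * y3)
    (2 * x0 * x3 + 2 * x1 * x2 + 2 * y0 * y3 + 2 * y1 * y2)
    (2 * x0 * y3 - 2 * x1 * y2 + 2 * x2 * y1 - 2 * x3 * y0)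
    (- 2 * x0 * x2 + 2 * x1 * x3 - 2 * y0 * y2 + 2 * y1 * y3)
    (- 2 * x0 * y2 - 2 * x1 * y3 + 2 * x2 * y0 + 2 * x3 * y1)
    (- x0 ^+ 2 + x1 ^+ 2 - x2 ^+ 2 + x3 ^+ 2 - y0 ^+ 2 + y1 ^+ 2 - y2 ^+ 2 + y3 ^+ 2)
    (- 2 * x0 * y1 + 2 * x1 * y0 - 2 * x2 * y3 + 2 * x3 * y2)
    (2 * x0 * x1 - 2 * x2 * x3 + 2 * y0 * y1 - 2 * y2 * y3)
    (2 * x0 * x1 + 2 * x2 * x3 + 2 * y0 * y1 + 2 * y2 * y3)
    (2 * x0 * y1 - 2 * x1 * y0 - 2 * x2 * y3 + 2 * x3 * y2)
    (- x0 ^+ 2 + x1 ^+ 2 + x2 ^+ 2 - x3 ^+ 2 - y0 ^+ 2 + y1 ^+ 2 + y2 ^+ 2 - y3 ^+ 2).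

Definition sqnorm (w : 'rV[C]_4) : R :=
  \sum_k (Re (w 0 k) ^+ 2 + Im (w 0 k) ^+ 2).

Lemma bivectorE (w v : 'rV[C]_4) (p := fun a b => w 0 a * v 0 b - w 0 b * v 0 a) :
  2 *: bivector w v = \row_k nth 0
    [:: p 'q0 'q1 + p 'q2 'q3; i * (p 'q0 'q1 - p 'q2 'q3);
        p 'q0 'q2 + p 'q3 'q1; i * (p 'q0 'q2 - p 'q3 'q1);
        p 'q0 'q3 + p 'q1 'q2; i * (p 'q0 'q3 - p 'q1 'q2)] k.
Proof.
rewrite /bivector /dual_e !ixE !inord4E -/(p _ _).
apply: combination_entries; by rewrite divff // pnatr_eq0.
Qed.

(* The adjoint of [bivector w] up to the factor [2]: interior product of [theta] with
   the conjugate of [w]. *)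
Definition contract (w : 'rV[C]_4) (theta : 'rV[C]_6) : 'rV[C]_4 :=
  let c k := conjc (w 0 k) in
  let P k l := theta 0 k + i * theta 0 l in
  let N k l := theta 0 k - i * theta 0 l in
  \row_(b < 4) nth 0
   [:: - c 'q1 * N 'o0 'o1 - c 'q2 * N 'o2 'o3 - c 'q3 * N 'o4 'o5;
       c 'q0 * N 'o0 'o1 + c 'q3 * P 'o2 'o3 - c 'q2 * P 'o4 'o5;
       - c 'q3 * P 'o0 'o1 + c 'q0 * N 'o2 'o3 + c 'q1 * P 'o4 'o5;
       c 'q2 * P 'o0 'o1 - c 'q1 * P 'o2 'o3 + c 'q0 * N 'o4 'o5] b.

Lemma bivector_contract (w : 'rV[C]_4) (theta : 'rV[C]_6) :
  2 *: bivector w (contract w theta) =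
  (sqnorm w)%:C%C *: theta - i *: (theta *m map_mx (real_complex R) (pointmx w)).
Proof.
rewrite bivectorE; apply/rowP; apply: forall_ord6; rewrite !mxE /sqnorm sum_ord4 sum_ord6 !mxE /=;
case: (w 0 'q0) (w 0 'q1) (w 0 'q2) (w 0 'q3) => [x0 y0] [x1 y1] [x2 y2] [x3 y3];
case: (theta 0 'o0) (theta 0 'o1) (theta 0 'o2) => [a0 b0] [a1 b1] [a2 b2];
case: (theta 0 'o3) (theta 0 'o4) (theta 0 'o5) => [a3 b3] [a4 b4] [a5 b5];
apply/eqP; rewrite eq_complex /=; apply/andP; split; apply/eqP; ring.
Qed.

End Projective.

(** * When a vector represents a structure *)

Section Represents.
Variable R : realType.
Local Notation C := R[i].
Local Notation Re := (@complex.Re R).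
Local Notation Im := (@complex.Im R).
Local Notation i := (Complex 0 1 : C).
Implicit Types (w v : 'rV[C]_4) (I : 'M[R]_6).

(** The interior product is an antiderivation, which gives one term for each factor of [w /\ v]. *)
Lemma contract_bivector w v :
  contract w (2 *: bivector w v) =
  2 *: ((sqnorm w)%:C%C *: v - (\sum_k v 0 k * conjc (w 0 k)) *: w).
Proof.
rewrite bivectorE /contract; apply/rowP; apply: forall_ord4; rewrite !mxE /sqnorm !sum_ord4 /=;
case: (w 0 'q0) (w 0 'q1) (w 0 'q2) (w 0 'q3) => [x0 y0] [x1 y1] [x2 y2] [x3 y3];
case: (v 0 'q0) (v 0 'q1) (v 0 'q2) (v 0 'q3) => [a0 b0] [a1 b1] [a2 b2] [a3 b3];
apply/eqP; rewrite eq_complex /=; apply/andP; split; apply/eqP; ring.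
Qed.

(** The multiple of [w] drops out because [w /\ w = 0]. *)
Lemma bivector_shift w v (a b : C) :
  2 *: bivector w (2 *: (a *: v - b *: w)) = (2 * a) *: (2 *: bivector w v).
Proof.
rewrite !bivectorE; apply/rowP; apply: forall_ord6; rewrite !mxE /=;
case: (w 0 'q0) (w 0 'q1) (w 0 'q2) (w 0 'q3) => [x0 y0] [x1 y1] [x2 y2] [x3 y3];
case: (v 0 'q0) (v 0 'q1) (v 0 'q2) (v 0 'q3) => [a0 b0] [a1 b1] [a2 b2] [a3 b3];
case: a b => [a4 b4] [a5 b5];
apply/eqP; rewrite eq_complex /=; apply/andP; split; apply/eqP; ring.
Qed.

(** The covector [bivector w (contract w th)] lies in [V_w], so it satisfies the eigenvector
    equation of [I]. For [th = e^k], the real part of that equation is row [k] of the claim. *)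
Lemma represents_pointmx w I : represents w I -> sqnorm w *: I = pointmx w.
Proof.
case=> _ _ eigI; apply/matrixP=> k j.
pose th : 'rV[C]_6 := delta_mx 0 k.
have /eigI /eigenspaceP H : exists v, bivector w (contract w th) = bivector w v by eexists.
have := congr1 (fun t => 2 *: t) H.
rewrite scalemxAl scalerA mulrC -scalerA bivector_contract mulmxBl -!scalemxAl -mulmxA -map_mxM.
move: (pointmx w) (sqnorm w) => M n.
rewrite -!rowE => /rowP /(_ j); rewrite !mxE => /(congr1 Re) /=.
case: (j == k) => /= E; lra.
Qed.

(** With [n = |w|^2], [bivector_contract] equates [2 w /\ contract w theta] with
    [n (theta - i theta I)]. On an eigenvector the right side is [2 n theta], so [theta] lies in
    [V_w]; on [V_w] the left side is [2 n theta], so [theta] is an eigenvector. *)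
Lemma pointmx_represents w I :
  Z I -> sqnorm w != 0 -> sqnorm w *: I = pointmx w -> represents w I.
Proof.
move=> ZI n0 nI.
have t0 : 2 != 0 :> C by rewrite pnatr_eq0.
have ii : i * i = -1 by rewrite -expr2 sqr_i.
pose n : C := (sqnorm w)%:C%C.
have nC : n != 0 by rewrite eq_complex /= eqxx andbT.
have nV (z : 'rV[C]_6) : n *: (n^-1 *: z) = z by rewrite scalerA mulfV // scale1r.
have MI (th : 'rV[C]_6) : th *m map_mx (real_complex R) (pointmx w) =
    n *: (th *m map_mx (real_complex R) I).
  by rewrite -nI map_mxZ scalemxAr.
split=> // [|th].
  by apply: contraNneq n0 => ->; rewrite /sqnorm big1 // => k _; rewrite mxE /= expr0n addr0.
split=> [/eigenspaceP thI|[v ->]].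
  exists (contract w (n^-1 *: th)).
  apply: (scalerI t0); rewrite bivector_contract MI -scalemxAl thI -/n !nV.
  by rewrite scalerA ii scaleN1r opprK scaler_nat mulr2n.
apply/eigenspaceP; apply: (scalerI t0); rewrite scalemxAl scalerA mulrC -scalerA.
set z := 2 *: _; apply: (scalerI nC).
have := bivector_contract w z; rewrite contract_bivector bivector_shift -/z -/n MI.
have -> : 2 * n = n + n by rewrite mulr_natl mulr2n.
rewrite scalerDl => /addrI E.
transitivity (i *: (n *: z)); last by rewrite !scalerA (mulrC i).
by rewrite E scalerN (scalerA i i) ii scaleN1r opprK.
Qed.

End Represents.

(** * Rotations from unit quaternions *)

Section Rotation.
Variable R : realType.

(** Some [T i i] is positive because the trace is; row [i] divided by the square root of [T i i]
    serves as [q]. *)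
Lemma rank_one_square (T : 'M[R]_4) :
  (forall i j k, T i j * T i k = T i i * T j k) -> \tr T = 1 ->
  exists q : 'I_4 -> R, forall j k, T j k = q j * q k.
Proof.
move=> rk1 tr1.
have [i Ti] : exists i, 0 < T i i.
  apply/existsP; apply: contraT; rewrite negb_exists => /forallP T0.
  have : \tr T <= 0 by apply: sumr_le0 => i _; rewrite leNgt T0.
  by rewrite tr1 ler10.
exists (fun j => T i j / Num.sqrt (T i i)) => j k.
rewrite mulrACA -invfM -expr2 sqr_sqrtr ?ltW // rk1 mulrAC divff ?mul1r //.
by rewrite gt_eqF.
Qed.

(** Products of two quaternion coordinates are affine in the entries of the rotation. The matrix of
    these products is therefore known first, and [rank_one_square] extracts the quaternion from
    it. *)
Lemma rotation_quaternion (b11 b12 b13 b21 b22 b23 b31 b32 b33 : R) :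
  b11 * b11 + b12 * b12 + b13 * b13 = 1 ->
  b11 * b21 + b12 * b22 + b13 * b23 = 0 ->
  b11 * b31 + b12 * b32 + b13 * b33 = 0 ->
  b21 * b21 + b22 * b22 + b23 * b23 = 1 ->
  b21 * b31 + b22 * b32 + b23 * b33 = 0 ->
  b31 * b31 + b32 * b32 + b33 * b33 = 1 ->
  b11 * (b22 * b33 - b23 * b32) - b12 * (b21 * b33 - b23 * b31)
    + b13 * (b21 * b32 - b22 * b31) = 1 ->
  exists a b c d : R, a ^+ 2 + b ^+ 2 + c ^+ 2 + d ^+ 2 = 1 /\
    [/\ [/\ b11 = 2 * (b * d - a * c), b12 = - 2 * (a * b + c * d) &
            b13 = - a ^+ 2 + b ^+ 2 + c ^+ 2 - d ^+ 2],
        [/\ b21 = 2 * (a * d + b * c),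
            b22 = - a ^+ 2 + b ^+ 2 - c ^+ 2 + d ^+ 2 & b23 = 2 * (a * b - c * d)] &
        [/\ b31 = - a ^+ 2 - b ^+ 2 + c ^+ 2 + d ^+ 2,
            b32 = 2 * (b * c - a * d) & b33 = 2 * (a * c + b * d)]].
Proof.
move=> r11 r12 r13 r22 r23 r33 det1.
(* Each entry equals its cofactor: multiply [B B^T = 1] by the adjugate of [B] and use
   [det B = 1]. *)
have c11 : (b22 * b33 - b23 * b32) = b11.
  have := congr1 (fun t => ((b22 * b33 - b23 * b32)) * t) r11.
  have := congr1 (fun t => (- (b12 * b33 - b13 * b32)) * t) r12.
  have := congr1 (fun t => ((b12 * b23 - b13 * b22)) * t) r13.
  have := congr1 (fun t => b11 * t) det1.
  by move=> /=; lra.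
have c12 : - (b21 * b33 - b23 * b31) = b12.
  have := congr1 (fun t => (- (b21 * b33 - b23 * b31)) * t) r11.
  have := congr1 (fun t => ((b11 * b33 - b13 * b31)) * t) r12.
  have := congr1 (fun t => (- (b11 * b23 - b13 * b21)) * t) r13.
  have := congr1 (fun t => b12 * t) det1.
  by move=> /=; lra.
have c13 : (b21 * b32 - b22 * b31) = b13.
  have := congr1 (fun t => ((b21 * b32 - b22 * b31)) * t) r11.
  have := congr1 (fun t => (- (b11 * b32 - b12 * b31)) * t) r12.
  have := congr1 (fun t => ((b11 * b22 - b12 * b21)) * t) r13.
  have := congr1 (fun t => b13 * t) det1.
  by move=> /=; lra.
have c21 : - (b12 * b33 - b13 * b32) = b21.
  have := congr1 (fun t => ((b22 * b33 - b23 * b32)) * t) r12.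
  have := congr1 (fun t => (- (b12 * b33 - b13 * b32)) * t) r22.
  have := congr1 (fun t => ((b12 * b23 - b13 * b22)) * t) r23.
  have := congr1 (fun t => b21 * t) det1.
  by move=> /=; lra.
have c22 : (b11 * b33 - b13 * b31) = b22.
  have := congr1 (fun t => (- (b21 * b33 - b23 * b31)) * t) r12.
  have := congr1 (fun t => ((b11 * b33 - b13 * b31)) * t) r22.
  have := congr1 (fun t => (- (b11 * b23 - b13 * b21)) * t) r23.
  have := congr1 (fun t => b22 * t) det1.
  by move=> /=; lra.
have c23 : - (b11 * b32 - b12 * b31) = b23.
  have := congr1 (fun t => ((b21 * b32 - b22 * b31)) * t) r12.
  have := congr1 (fun t => (- (b11 * b32 - b12 * b31)) * t) r22.
  have := congr1 (fun t => ((b11 * b22 - b12 * b21)) * t) r23.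
  have := congr1 (fun t => b23 * t) det1.
  by move=> /=; lra.
have c31 : (b12 * b23 - b13 * b22) = b31.
  have := congr1 (fun t => ((b22 * b33 - b23 * b32)) * t) r13.
  have := congr1 (fun t => (- (b12 * b33 - b13 * b32)) * t) r23.
  have := congr1 (fun t => ((b12 * b23 - b13 * b22)) * t) r33.
  have := congr1 (fun t => b31 * t) det1.
  by move=> /=; lra.
have c32 : - (b11 * b23 - b13 * b21) = b32.
  have := congr1 (fun t => (- (b21 * b33 - b23 * b31)) * t) r13.
  have := congr1 (fun t => ((b11 * b33 - b13 * b31)) * t) r23.
  have := congr1 (fun t => (- (b11 * b23 - b13 * b21)) * t) r33.
  have := congr1 (fun t => b32 * t) det1.
  by move=> /=; lra.
have c33 : (b11 * b22 - b12 * b21) = b33.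
  have := congr1 (fun t => ((b21 * b32 - b22 * b31)) * t) r13.
  have := congr1 (fun t => (- (b11 * b32 - b12 * b31)) * t) r23.
  have := congr1 (fun t => ((b11 * b22 - b12 * b21)) * t) r33.
  have := congr1 (fun t => b33 * t) det1.
  by move=> /=; lra.
(* The columns are orthonormal as well: with one factor replaced by its cofactor, the sum is
   [det B], or a determinant with two equal columns. *)
have k11 : b11 * b11 + b21 * b21 + b31 * b31 = 1.
  have := congr1 (fun t => b11 * t) c11.
  have := congr1 (fun t => b21 * t) c21.
  have := congr1 (fun t => b31 * t) c31.
  by move=> /=; lra.
have k12 : b11 * b12 + b21 * b22 + b31 * b32 = 0.
  have := congr1 (fun t => b11 * t) c12.
  have := congr1 (fun t => b21 * t) c22.
  have := congr1 (fun t => b31 * t) c32.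
  by move=> /=; lra.
have k13 : b11 * b13 + b21 * b23 + b31 * b33 = 0.
  have := congr1 (fun t => b11 * t) c13.
  have := congr1 (fun t => b21 * t) c23.
  have := congr1 (fun t => b31 * t) c33.
  by move=> /=; lra.
have k22 : b12 * b12 + b22 * b22 + b32 * b32 = 1.
  have := congr1 (fun t => b12 * t) c12.
  have := congr1 (fun t => b22 * t) c22.
  have := congr1 (fun t => b32 * t) c32.
  by move=> /=; lra.
have k23 : b12 * b13 + b22 * b23 + b32 * b33 = 0.
  have := congr1 (fun t => b12 * t) c13.
  have := congr1 (fun t => b22 * t) c23.
  have := congr1 (fun t => b32 * t) c33.
  by move=> /=; lra.
have k33 : b13 * b13 + b23 * b23 + b33 * b33 = 1.
  have := congr1 (fun t => b13 * t) c13.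
  have := congr1 (fun t => b23 * t) c23.
  have := congr1 (fun t => b33 * t) c33.
  by move=> /=; lra.
(* For the quaternion [q] sought, [T = 4 q^T q]. *)
pose T : 'M[R]_4 := mxseq 4
  [:: [:: 1 - b13 - b22 - b31; b23 - b12; b33 - b11; b21 - b32];
      [:: b23 - b12; 1 + b13 + b22 - b31; b21 + b32; b33 + b11];
      [:: b33 - b11; b21 + b32; 1 + b13 - b22 + b31; - (b12 + b23)];
      [:: b21 - b32; b33 + b11; - (b12 + b23); 1 - b13 + b22 + b31]].
have trT : \tr (4^-1 *: T) = 1.
  rewrite mxtraceZ /mxtrace sum_ord4 !mxE /=; lra.
(* Every case is a linear combination of the relations above, products of entries being atoms. *)
have rk1 i j k : (4^-1 *: T) i j * (4^-1 *: T) i k = (4^-1 *: T) i i * (4^-1 *: T) j k.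
  rewrite ![(4^-1 *: T) _ _]mxE mulrACA [RHS]mulrACA; congr (_ * _).
  rewrite !mxE; move: i j k; do 3!apply: forall_ord4; rewrite /=; lra.
have [q qE] := rank_one_square rk1 trT.
have {}qE i j : T i j = 4 * (q i * q j).
  by have := qE i j; rewrite [LHS]mxE; move: (T i j) => t qt; lra.
have := (qE 'q0 'q0, qE 'q1 'q1, qE 'q2 'q2, qE 'q3 'q3).
have := (qE 'q0 'q1, qE 'q0 'q2, qE 'q0 'q3, qE 'q1 'q2, qE 'q1 'q3, qE 'q2 'q3).
move=> [[[[[q01 q02] q03] q12] q13] q23] [[[q00 q11] q22] q33].
rewrite !mxE /= in q01 q02 q03 q12 q13 q23 q00 q11 q22 q33.
exists (q 'q0), (q 'q1), (q 'q2), (q 'q3).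
by split; [lra | split; split; lra].
Qed.
End Rotation.

(** * Maximal structures and equators *)

Section Equators.
Variable R : realType.
Local Notation C := R[i].
Local Notation Re := (@complex.Re R).
Local Notation Im := (@complex.Im R).
Implicit Types (w v : 'rV[C]_4) (I : 'M[R]_6).
Local Notation E i := (delta_mx i 0 : 'cV[R]_6).

Lemma dotmxC (u v : 'rV[C]_4) : dotmx u v = \sum_k u 0 k * conjc (v 0 k).
Proof. by rewrite dotmxE mxE; apply: eq_bigr => k _; rewrite !mxE. Qed.

Lemma dotmx_sqnorm w : dotmx w w = (sqnorm w)%:C%C.
Proof.
rewrite dotmxC /sqnorm rmorph_sum; apply: eq_bigr => k _.
by case: (w 0 k) => x y; apply/eqP; rewrite eq_complex /=; apply/andP; split; apply/eqP; ring.
Qed.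

Definition offdiagonal I : Prop :=
  [/\ I 'o0 'o1 = 0, I 'o0 'o2 = 0 & I 'o1 'o2 = 0] /\
  [/\ I 'o3 'o4 = 0, I 'o3 'o5 = 0 & I 'o4 'o5 = 0].

(** The norm is at most 48, with equality exactly when the diagonal blocks vanish, so a structure
    attaining 48 has to be exhibited. *)
Lemma ANKP I : ANK I <-> Z I /\ offdiagonal I.
Proof.
split=> [[ZI maxI]|[ZI [[I01 I02 I12] [I34 I35 I45]]]]; split=> //; last first.
  move=> J ZJ.
  rewrite !nijenhuis_norm2E // I01 I02 I12 I34 I35 I45 !expr0n /=.
  have := (sqr_ge0 (J 'o0 'o1), sqr_ge0 (J 'o0 'o2), sqr_ge0 (J 'o1 'o2)).
  have := (sqr_ge0 (J 'o3 'o4), sqr_ge0 (J 'o3 'o5), sqr_ge0 (J 'o4 'o5)).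
  by move=> [[? ?] ?] [[? ?] ?]; lra.
(* The block [B] of [J] is minus the antidiagonal permutation matrix, which has determinant 1. *)
pose J : 'M[R]_6 := skew6 0 0 0 0 (-1) 0 0 (-1) 0 (-1) 0 0 0 0 0.
have sJ i j : J i j = - J j i by exact: skew6_skew.
have J2 : J *m J = - 1%:M.
  by apply/matrixP; do 2!apply: forall_ord6; rewrite !mxE sum_ord6 !mxE /=; ring.
have ZJ : Z J.
  apply: (@Z_of_frame _ _ (E 'o0) (E 'o1) (E 'o2) J2 sJ).
  by rewrite det_frame_blocks ?mxE //=; lra.
have := maxI J ZJ; rewrite !nijenhuis_norm2E // !mxE /=.
have := (sqr_ge0 (I 'o0 'o1), sqr_ge0 (I 'o0 'o2), sqr_ge0 (I 'o1 'o2)).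
have := (sqr_ge0 (I 'o3 'o4), sqr_ge0 (I 'o3 'o5), sqr_ge0 (I 'o4 'o5)).
move=> [[? ?] ?] [[? ?] ?] le0.
by split; split; apply/eqP; rewrite -sqrf_eq0; apply/eqP; lra.
Qed.

Lemma addsq_eq0 (a b : R) : a ^+ 2 + b ^+ 2 = 0 -> a = 0 /\ b = 0.
Proof.
move=> /eqP; rewrite paddr_eq0 ?sqr_ge0 // !sqrf_eq0.
by case/andP=> /eqP-> /eqP->.
Qed.

Lemma represents_unit w I : represents w I -> dotmx w w = 1 ->
  sqnorm w = 1 /\ I = pointmx w.
Proof.
move=> wI; rewrite dotmx_sqnorm => -[n1]; split=> //.
by rewrite -(represents_pointmx wI) n1 scale1r.
Qed.

Lemma sqnormE w : sqnorm w =
  Re (w 0 'q0) ^+ 2 + Im (w 0 'q0) ^+ 2 + (Re (w 0 'q1) ^+ 2 + Im (w 0 'q1) ^+ 2)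
  + (Re (w 0 'q2) ^+ 2 + Im (w 0 'q2) ^+ 2) + (Re (w 0 'q3) ^+ 2 + Im (w 0 'q3) ^+ 2).
Proof. by rewrite /sqnorm sum_ord4. Qed.

(* With [p = conj w0 * w3 + conj w1 * w2] and [q = w0 * conj w1 + conj w2 * w3], the
   last two hypotheses say [p = 0], the entries in rows 4 to 6 vanish when [q = 0], and
   [|q|^2 - |p|^2 = (|w0|^2 - |w2|^2) (|w1|^2 - |w3|^2)]. *)
Lemma offdiagonal_pointmx w :
  let x0 := Re (w 0 'q0) in let y0 := Im (w 0 'q0) in
  let x1 := Re (w 0 'q1) in let y1 := Im (w 0 'q1) in
  let x2 := Re (w 0 'q2) in let y2 := Im (w 0 'q2) in
  let x3 := Re (w 0 'q3) in let y3 := Im (w 0 'q3) in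
  x0 ^+ 2 + y0 ^+ 2 = x2 ^+ 2 + y2 ^+ 2 -> x1 ^+ 2 + y1 ^+ 2 = x3 ^+ 2 + y3 ^+ 2 ->
  x0 * x3 + y0 * y3 + (x1 * x2 + y1 * y2) = 0 ->
  x0 * y3 - y0 * x3 + (x1 * y2 - y1 * x2) = 0 ->
  offdiagonal (pointmx w).
Proof.
rewrite /pointmx /offdiagonal !mxE /=.
case: (w 0 'q0) (w 0 'q1) (w 0 'q2) (w 0 'q3) => [x0 y0] [x1 y1] [x2 y2] [x3 y3] /=.
move=> n02 n13 p1 p2.
have [q1 q2] : x0 * x1 + y0 * y1 + (x2 * x3 + y2 * y3) = 0 /\
               x0 * y1 - y0 * x1 - (x2 * y3 - y2 * x3) = 0.
  apply: addsq_eq0.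
  transitivity ((x0 * x3 + y0 * y3 + (x1 * x2 + y1 * y2)) ^+ 2
    + (x0 * y3 - y0 * x3 + (x1 * y2 - y1 * x2)) ^+ 2
    + ((x0 ^+ 2 + y0 ^+ 2) - (x2 ^+ 2 + y2 ^+ 2))
      * ((x1 ^+ 2 + y1 ^+ 2) - (x3 ^+ 2 + y3 ^+ 2))); first by ring.
  by rewrite n02 subrr p1 p2 !expr0n /= mul0r !addr0.
by split; split; lra.
Qed.

(** The poles force [zh] into the span of [v^0, v^3] and [uh] into that of [v^1, v^2]; their first
    rows share [r], [x], [u], and eliminating these gives the hypotheses of
    [offdiagonal_pointmx]. *)
Lemma offdiagonal_equator r x u (pp pm I : 'M[R]_6) :
  fundamental_form pp = omega_plus r x u ->
  fundamental_form pm = omega_minus r x u ->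
  equator pp pm I -> Z I /\ offdiagonal I.
Proof.
rewrite -fundamental_form_polemx_plus -fundamental_form_polemx_minus.
move=> /fundamental_form_inj-> /fundamental_form_inj->.
case=> zh [uh [zP uM [zz uu _] [tau tau1 wI]]].
split; first by case: wI.
have [nz /matrixP Pz] := represents_unit zP zz.
have [nu /matrixP Pu] := represents_unit uM uu.
have {}tau1 : Re tau ^+ 2 + Im tau ^+ 2 = 1.
  by have := add_Re2_Im2 tau; rewrite tau1 expr1n => -[].
set w := uh + tau *: zh in wI.
suff [n2 offw] : sqnorm w = 2 /\ offdiagonal (pointmx w).
  have := represents_pointmx wI; rewrite n2 => I2.
  move: offw; rewrite -I2 /offdiagonal !mxE => -[[? ? ?] [? ? ?]].
  by split; split; lra.
move: (Pz 'o0 'o1) (Pz 'o0 'o2) (Pz 'o0 'o3) (Pz 'o4 'o5).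
move: (Pu 'o0 'o1) (Pu 'o0 'o2) (Pu 'o0 'o3) (Pu 'o4 'o5).
rewrite !mxE /= {Pz Pu zP uM wI zz uu}.
rewrite !sqnormE in nz nu *.
have := @offdiagonal_pointmx w.
rewrite /w !mxE.
case: (zh 0 'q0) (zh 0 'q1) (zh 0 'q2) (zh 0 'q3) nz => [a0 b0] [a1 b1] [a2 b2] [a3 b3].
case: (uh 0 'q0) (uh 0 'q1) (uh 0 'q2) (uh 0 'q3) nu => [c0 d0] [c1 d1] [c2 d2] [c3 d3].
case: tau tau1 {w} => s t /= st1 nu nz off u01 u02 u03 u45 z01 z02 z03 z45.
(* For the unit vector [zh], entry [(5, 6)] equal to [-1] makes coordinates 1 and 2 vanish. For [uh]
   this entry is [1], which makes coordinates 0 and 3 vanish. *)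
have [a10 b10] : a1 = 0 /\ b1 = 0.
  apply: addsq_eq0; have := (sqr_ge0 a1, sqr_ge0 b1, sqr_ge0 a2, sqr_ge0 b2).
  by move=> -[[[? ?] ?] ?]; lra.
have [a20 b20] : a2 = 0 /\ b2 = 0.
  apply: addsq_eq0; have := (sqr_ge0 a1, sqr_ge0 b1, sqr_ge0 a2, sqr_ge0 b2).
  by move=> -[[[? ?] ?] ?]; lra.
have [c00 d00] : c0 = 0 /\ d0 = 0.
  apply: addsq_eq0; have := (sqr_ge0 c0, sqr_ge0 d0, sqr_ge0 c3, sqr_ge0 d3).
  by move=> -[[[? ?] ?] ?]; lra.
have [c30 d30] : c3 = 0 /\ d3 = 0.
  apply: addsq_eq0; have := (sqr_ge0 c0, sqr_ge0 d0, sqr_ge0 c3, sqr_ge0 d3).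
  by move=> -[[[? ?] ?] ?]; lra.
subst a1 b1 a2 b2 c0 d0 c3 d3.
(* Coordinates 0 and 3 of [w] carry the factor [tau]; these multiples of [|tau|^2 = 1] remove it
   from the quadratic conditions. *)
have N0 := congr1 (fun z => z * (a0 ^+ 2 + b0 ^+ 2)) st1.
have N3 := congr1 (fun z => z * (a3 ^+ 2 + b3 ^+ 2)) st1.
have K1 := congr1 (fun z => z * (a0 * a3 + b0 * b3)) st1.
have K2 := congr1 (fun z => z * (a0 * b3 - b0 * a3)) st1.
rewrite /= in N0 N3 K1 K2.
split; first by lra.
by apply: off; lra.
Qed.

Lemma Z_orthonormal I j k : Z I -> \sum_l I j l * I k l = (j == k)%:R.
Proof.
move=> ZI; have /matrixP/(_ j k) : I *m I = - 1%:M by case: ZI.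
rewrite !mxE => /(congr1 -%R); rewrite opprK -sumrN => <-.
by apply: eq_bigr => l _; rewrite (Z_skew ZI k l) mulrN.
Qed.

Lemma gram_det (b11 b12 b13 b21 b22 b23 b31 b32 b33 : R) :
  let g11 := b11 * b11 + b12 * b12 + b13 * b13 in
  let g12 := b11 * b21 + b12 * b22 + b13 * b23 in
  let g13 := b11 * b31 + b12 * b32 + b13 * b33 in
  let g22 := b21 * b21 + b22 * b22 + b23 * b23 in
  let g23 := b21 * b31 + b22 * b32 + b23 * b33 in
  let g33 := b31 * b31 + b32 * b32 + b33 * b33 in
  (b11 * (b22 * b33 - b23 * b32) - b12 * (b21 * b33 - b23 * b31)
   + b13 * (b21 * b32 - b22 * b31)) ^+ 2 =
  g11 * (g22 * g33 - g23 ^+ 2) - g12 * (g12 * g33 - g23 * g13)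
  + g13 * (g12 * g23 - g22 * g13).
Proof. by move=> /=; ring. Qed.

(** [I I^T = 1] makes the rows of [B] orthonormal, so [(det B)^2 = 1] by [gram_det]; the orientation
    gives [det B >= 0], hence [det B = 1]. *)
Lemma offdiagonal_quaternion I : Z I -> offdiagonal I ->
  exists a b c d : R, a ^+ 2 + b ^+ 2 + c ^+ 2 + d ^+ 2 = 1 /\
  I = skew6 0 0 (2 * (b * d - a * c)) (- 2 * (a * b + c * d))
        (- a ^+ 2 + b ^+ 2 + c ^+ 2 - d ^+ 2)
        0 (2 * (a * d + b * c)) (- a ^+ 2 + b ^+ 2 - c ^+ 2 + d ^+ 2) (2 * (a * b - c * d))
        (- a ^+ 2 - b ^+ 2 + c ^+ 2 + d ^+ 2) (2 * (b * c - a * d)) (2 * (a * c + b * d))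
        0 0 0.
Proof.
move=> ZI [[I01 I02 I12] [I34 I35 I45]].
have sI := Z_skew ZI.
have det0 := frame_ge0 (E 'o0) (E 'o1) (E 'o2) ZI.
rewrite (det_frame_blocks sI I01 I02 I12) in det0.
have I0 k : I k k = 0 by have := sI k k; lra.
have h j k := Z_orthonormal j k ZI.
have := (h 'o0 'o0, h 'o0 'o1, h 'o0 'o2, h 'o1 'o1, h 'o1 'o2, h 'o2 'o2).
rewrite !sum_ord6 !I0 (sI 'o1 'o0) (sI 'o2 'o0) (sI 'o2 'o1) I01 I02 I12 oppr0.
rewrite ?(mul0r, mulr0, add0r) /= => -[[[[[h00 h01] h02] h11] h12] h22].
have det1 : I 'o0 'o3 * (I 'o1 'o4 * I 'o2 'o5 - I 'o1 'o5 * I 'o2 'o4)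
    - I 'o0 'o4 * (I 'o1 'o3 * I 'o2 'o5 - I 'o1 'o5 * I 'o2 'o3)
    + I 'o0 'o5 * (I 'o1 'o3 * I 'o2 'o4 - I 'o1 'o4 * I 'o2 'o3) = 1.
  apply/eqP; rewrite -(@pexpr_eq1 _ _ 2) // gram_det /=.
  by rewrite h00 h01 h02 h11 h12 h22; apply/eqP; ring.
have [a [b [c [d [n1 [[b11 b12 b13] [b21 b22 b23] [b31 b32 b33]]]]]]] :=
  rotation_quaternion h00 h01 h02 h11 h12 h22 det1.
exists a, b, c, d; split=> //.
by rewrite [LHS](skew6E sI) I01 I02 I12 I34 I35 I45 b11 b12 b13 b21 b22 b23 b31 b32 b33.
Qed.

Lemma equator_of_offdiagonal I : Z I -> offdiagonal I ->
  exists r x u : R, r ^+ 2 + x ^+ 2 + u ^+ 2 = 1 /\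
    equator (polemx 1 r x u) (polemx (-1) (- r) (- x) u) I.
Proof.
move=> ZI /(offdiagonal_quaternion ZI)[a [b [c [d [n1 IE]]]]].
(* The vector attached to the quaternion is split into its parts in the spans of [v^0, v^3] and of
   [v^1, v^2], where [p_+] and [p_-] lie. *)
pose zh : 'rV[C]_4 := \row_k nth 0 [:: Complex a b; 0; 0; Complex (- c) d] k.
pose uh : 'rV[C]_4 := \row_k nth 0 [:: 0; Complex c d; Complex a (- b); 0] k.
(* Minus the entries [(1, 2)], [(1, 3)], [(1, 4)] of [pointmx zh]: a Hopf map, so the unit sphere
   goes to the unit sphere. *)
exists (a ^+ 2 + b ^+ 2 - c ^+ 2 - d ^+ 2), (2 * (a * d + b * c)), (2 * (a * c - b * d)).
set r := a ^+ 2 + _ - _ - _; set x := 2 * _; set u := 2 * _.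
have ru1 : r ^+ 2 + x ^+ 2 + u ^+ 2 = 1.
  transitivity ((a ^+ 2 + b ^+ 2 + c ^+ 2 + d ^+ 2) ^+ 2); last by rewrite n1 expr1n.
  by rewrite /r /x /u; ring.
split=> //; exists zh, uh.
have nz : sqnorm zh = 1 by rewrite sqnormE !mxE /= -n1; ring.
have nu : sqnorm uh = 1 by rewrite sqnormE !mxE /= -n1; ring.
split.
- apply: pointmx_represents; rewrite ?nz ?oner_eq0 // ?scale1r.
    by apply: Z_polemx ru1; rewrite expr1n.
  by rewrite /pointmx /polemx !mxE /= /r /x /u; congr skew6; lra.
- apply: pointmx_represents; rewrite ?nu ?oner_eq0 // ?scale1r.
    by apply: Z_polemx; rewrite ?sqrrN ?expr1n.
  by rewrite /pointmx /polemx !mxE /= /r /x /u; congr skew6; lra.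
- split; rewrite ?dotmx_sqnorm ?nz ?nu // dotmxC sum_ord4 !mxE /=.
  by apply/eqP; rewrite eq_complex /=; apply/andP; split; apply/eqP; ring.
(* The phases of [zh] and [uh] were chosen so that their sum itself represents [I]. *)
exists 1; first exact: normr1.
rewrite scale1r.
have wE : uh + zh = \row_k nth 0 [:: Complex a b; Complex c d; Complex a (- b); Complex (- c) d] k.
  by apply/rowP; apply: forall_ord4; rewrite !mxE /= ?addr0 ?add0r.
have nw : sqnorm (uh + zh) = 2 by rewrite wE sqnormE !mxE /=; lra.
apply: pointmx_represents; rewrite ?nw ?pnatr_eq0 // wE.
rewrite [in LHS]IE; apply/matrixP; do 2!apply: forall_ord6; rewrite !mxE /=; lra.
Qed.

End Equators.

Theorem mainTheorem1 (R : realType) :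
  (ANK : set 'M[R]_6) =
  \bigcup_(t in [set t : R * R * R |
                 t.1.1 ^+ 2 + t.1.2 ^+ 2 + t.2 ^+ 2 = 1])
    let: (r, x, u) := t in
    [set I : 'M[R]_6 | exists p_plus p_minus : 'M[R]_6,
      [/\ Z p_plus /\ fundamental_form p_plus = omega_plus r x u,
          Z p_minus /\ fundamental_form p_minus = omega_minus r x u &
          equator p_plus p_minus I]].
Proof.
apply/seteqP; split=> [I /ANKP[ZI /(equator_of_offdiagonal ZI)]|I].
  move=> [r [x [u [ru1 eqI]]]]; exists (r, x, u) => //.
  exists (polemx 1 r x u), (polemx (-1) (- r) (- x) u).
  rewrite fundamental_form_polemx_plus fundamental_form_polemx_minus; split=> //; split=> //.
    by apply: Z_polemx ru1; rewrite expr1n.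
  by apply: Z_polemx; rewrite ?sqrrN ?expr1n.
case=> -[[r x] u] _ [pp [pm [[_ ppE] [_ pmE] eqI]]].
by apply/ANKP; apply: offdiagonal_equator ppE pmE eqI.
Qed.
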